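(* Let $T$ be a complete first-order theory with monster model $\mathcal M$, let $E$ be an $\emptyset$-type-definable equivalence relation, $a$ a (possibly infinite, small) real tuple, and $\boldsymbol e=a/E$ a hyperimaginary. Then the Lascar group $\operatorname{Gal}_{\operatorname L}(T,\boldsymbol e)$ over $\boldsymbol e$, with its quotient topology, is a quasi-compact topological group (not necessarily Hausdorff).
   Context: Conventions: $\mathcal M$ is a ($\bar\kappa$-saturated) monster model of $T$; small/bounded means of cardinality $<\bar\kappa$; real tuples are sequences from $\mathcal M$ of small length. A hyperimaginary $b_F=b/F$ is the class of a real tuple $b$ modulo an $\emptyset$-type-definable equivalence relation $F$. For a hyperimaginary $\boldsymbol e$, $\operatorname{Aut}_{\boldsymbol e}(\mathcal M)=\{f\in\operatorname{Aut}(\mathcal M): f(\boldsymbol e)=\boldsymbol e\}$ (setwise fixing the class). For a small elementary submodel $M\prec\mathcal M$, $\boldsymbol e\in\operatorname{dcl}(M)$ means that every automorphism fixing $M$ pointwise fixes $\boldsymbol e$. $\operatorname{Autf}_{\boldsymbol e}(\mathcal M)$ is the (normal) subgroup of $\operatorname{Aut}_{\boldsymbol e}(\mathcal M)$ generated by all $f\in \operatorname{Aut}_{\boldsymbol e}(\mathcal M)$ that fix pointwise some model $M$ with $\boldsymbol e\in\operatorname{dcl}(M)$. The Lascar group is $\operatorname{Gal}_{\operatorname L}(T,\boldsymbol e)=\operatorname{Aut}_{\boldsymbol e}(\mathcal M)/\operatorname{Autf}_{\boldsymbol e}(\mathcal M)$; it does not depend on $\mathcal M$ up to isomorphism. Topology: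 fix small models $M,N\prec\mathcal M$ with $\boldsymbol e\in\operatorname{dcl}(M)$ and $\boldsymbol e\in\operatorname{dcl}(N)$, and let $S_M(N)=\{\operatorname{tp}(f(M)/N): f\in\operatorname{Aut}_{\boldsymbol e}(\mathcal M)\}$ with the relative Stone topology. The map $\nu:S_M(N)\to\operatorname{Gal}_{\operatorname L}(T,\boldsymbol e)$, $\operatorname{tp}(f(M)/N)\mapsto f\cdot\operatorname{Autf}_{\boldsymbol e}(\mathcal M)$, is well defined and surjective, and $\operatorname{Gal}_{\operatorname L}(T,\boldsymbol e)$ carries the quotient topology with respect to $\nu$; it does not depend on the choice of $M,N$. A topological group is a group with a topology for which multiplication and inversion are continuous. Quasi-compact means every open cover has a finite subcover (no Hausdorff assumption). *)

(* Defs.v *)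
From HB Require Import structures.
From mathcomp Require Import all_boot all_classical topology.

Set Implicit Arguments.
Unset Strict Implicit.
Unset Printing Implicit Defensive.

Local Open Scope classical_set_scope.
Local Open Scope group_scope.

Record language := Language {
  fsym : Type;
  farity : fsym -> nat;
  rsym : Type;
  rarity : rsym -> nat }.

(** [term L V] and [formula L V] have their free variables in the arbitrary
    type [V]; a quantifier binds the extra variable [None] of [option V]. *)
Inductive term (L : language) (V : Type) : Type :=
| Var of V
| App (f : fsym L) of ('I_(farity f) -> term L V).

Inductive formula (L : language) (V : Type) : Type :=
| Eqn of term L V & term L V
| Rel (r : rsym L) of ('I_(rarity r) -> term L V)
| Bot
| Imp of formula L V & formula L V
| All of formula L (option V).

Arguments Bot {L V}.

Definition Neg L V (phi : formula L V) : formula L V := Imp phi Bot.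

HB.instance Definition _ L V := gen_eqMixin (formula L V).
HB.instance Definition _ L V := gen_choiceMixin (formula L V).
HB.instance Definition _ L V := isPointed.Build (formula L V) Bot.

Record structure (L : language) := Structure {
  carrier :> Type;
  carrier_inhabited : inhabited carrier;
  finterp : forall f : fsym L, ('I_(farity f) -> carrier) -> carrier;
  rinterp : forall r : rsym L, ('I_(rarity r) -> carrier) -> Prop }.

Arguments finterp {L} _ _ _.
Arguments rinterp {L} _ _ _.

Definition extend (S V : Type) (v : V -> S) (x : S) (o : option V) : S :=
  if o is Some i then v i else x.

Fixpoint eval L (S : structure L) V (v : V -> S) (t : term L V) : S :=
  match t with
  | Var i => v i
  | App f ts => finterp S f (fun k => eval v (ts k))
  end.

Fixpoint sat L (S : structure L) V (v : V -> S) (phi : formula L V) : Prop :=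
  match phi with
  | Eqn t u => eval v t = eval v u
  | Rel r ts => rinterp S r (fun k => eval v (ts k))
  | Bot => False
  | Imp phi psi => sat v phi -> sat v psi
  | All phi => forall x : S, sat (extend v x) phi
  end.

Definition sentence L := formula L void.
Definition holds L (S : structure L) (phi : sentence L) : Prop :=
  sat (of_void S) phi.

Definition theory L := set (sentence L).
Definition is_model L (T : theory L) (S : structure L) : Prop :=
  forall phi, T phi -> holds S phi.
Definition entails L (T : theory L) (phi : sentence L) : Prop :=
  forall S : structure L, is_model T S -> holds S phi.
Definition complete_theory L (T : theory L) : Prop :=
  (exists S : structure L, is_model T S) /\
  (forall phi, entails T phi \/ entails T (Neg phi)).

Section Submodel.
Context (L : language) (S : structure L).
Implicit Type A : set S.

Definition fclosed A : Prop :=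
  forall f (xs : 'I_(farity f) -> S), (forall k, A (xs k)) ->
  A (finterp S f xs).

Lemma induced_subproof A (Acl : fclosed A) f (xs : 'I_(farity f) -> A) :
  finterp S f (fun k => val (xs k)) \in A.
Proof. by apply/mem_set/Acl => k; exact: set_valP. Qed.

Lemma induced_inhabited A : A !=set0 -> inhabited A.
Proof.
by case=> x Ax; exists; exact: (exist (fun x => x \in A) x (mem_set Ax)).
Qed.

Definition induced A (A0 : A !=set0) (Acl : fclosed A) : structure L :=
  {| carrier := A;
     carrier_inhabited := induced_inhabited A0;
     finterp := fun f xs =>
       exist (fun x => x \in A) _ (induced_subproof Acl xs);
     rinterp := fun r xs => rinterp S r (fun k => val (xs k)) |}.

Definition elementary_submodel A : Prop :=
  exists (A0 : A !=set0) (Acl : fclosed A),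
    forall V (v : V -> induced A0 Acl) (phi : formula L V),
    sat v phi <-> sat (val \o v : V -> S) phi.

End Submodel.

Section Types.
Context (L : language) (S : structure L).
Implicit Types (X : Type) (A : set S).

(** A formula over [A] in the tuple of variables [X] is an element of
    [formula L (X + A)]: the variables from [A] are read as parameters. *)
Definition assign X A (b : X -> S) (i : X + A) : S :=
  match i with inl x => b x | inr c => val c end.

Definition finitely_satisfiable X A (p : set (formula L (X + A))) : Prop :=
  forall F, finite_set F -> F `<=` p ->
  exists b : X -> S, forall phi, F phi -> sat (assign b) phi.

(** Consistency with the elementary diagram of [A] is finite satisfiability in
    the ambient structure. *)
Definition complete_type X A : set (set (formula L (X + A))) :=
  [set p | finitely_satisfiable p /\ forall phi, p phi \/ p (Neg phi)].
Arguments complete_type : clear implicits.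

Definition stone X A : Type :=
  {p : set (formula L (X + A)) | p \in complete_type X A}.
Arguments stone : clear implicits.

HB.instance Definition _ X A := SubType.on (stone X A).
HB.instance Definition _ X A := [Choice of stone X A by <:].
HB.instance Definition _ X A := isSubBaseTopological.Build (stone X A)
  (@setT (formula L (X + A))) (fun phi => [set p | val p phi]).

Lemma tp_subproof X A (b : X -> S) :
  [set phi | sat (assign (A := A) b) phi] \in complete_type X A.
Proof.
apply/mem_set; split=> [F _ Fp|phi]; first by exists b => phi /Fp.
exact: EM.
Qed.

Definition tp X A (b : X -> S) : stone X A :=
  exist (fun p => p \in complete_type X A) _ (tp_subproof A b).

End Types.
Arguments complete_type {L S} X A.
Arguments stone {L S} X A.

(** [|A| < |K|]; a cardinal is represented by a type [K] of that size. *)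
Definition small (K T : Type) (A : set T) : Prop :=
  (A #<= [set: K])%card /\ ~ ([set: K] #<= A)%card.

(** Realization of partial 1-types over small sets; equivalently (extend to a
    complete type) of complete ones. *)
Definition saturated (K : Type) L (S : structure L) : Prop :=
  forall A : set S, small K A ->
  forall p : set (formula L (unit + A)), finitely_satisfiable p ->
  exists c : unit -> S, forall phi, p phi -> sat (assign c) phi.

Definition automorphism L (S : structure L) (f : S -> S) : Prop :=
  [/\ bijective f,
      forall s xs, f (finterp S s xs) = finterp S s (f \o xs) &
      forall r xs, rinterp S r (f \o xs) <-> rinterp S r xs].

Definition strongly_homogeneous (K : Type) L (S : structure L) : Prop :=
  forall I : Type, small K [set: I] -> forall b c : I -> S,
  (forall phi : formula L I, sat b phi <-> sat c phi) ->
  exists2 f : S -> S, automorphism f & f \o b = c.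

(** [formula L nat] has cardinality [|L| + aleph_0]. *)
Definition monster (K : Type) L (T : theory L) (S : structure L) : Prop :=
  [/\ is_model T S, small K [set: formula L nat], saturated K S &
      strongly_homogeneous K S].

Section Automorphism.
Context (L : language) (S : structure L).

Record aut := Aut { aut_fun :> S -> S; autP : automorphism aut_fun }.

HB.instance Definition _ := gen_eqMixin aut.
HB.instance Definition _ := gen_choiceMixin aut.

Lemma aut_eq (f g : aut) : f =1 g -> f = g.
Proof.
case: f g => [f fP] [g gP] /= /funext fg.
by case: _ / fg in gP *; congr Aut; exact: Prop_irrelevance.
Qed.

Lemma aut1_subproof : automorphism (@id S).
Proof. by split=> //; exists id. Qed.

Lemma autM_subproof (f g : aut) : automorphism (f \o g).
Proof.
case: (autP f) (autP g) => [bf ff rf] [bg fg rg]; split.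
- exact: bij_comp.
- by move=> s xs /=; rewrite fg ff.
- by move=> r xs; rewrite -(rg r xs) -(rf r (g \o xs)).
Qed.

Lemma autV_exists (f : aut) :
  {g : S -> S | [/\ cancel f g, cancel g f & automorphism g]}.
Proof.
apply: cid; case: (autP f) => [[g fK gK] ff rf]; exists g; split=> //; split.
- by exists f.
- move=> s xs; apply: (can_inj fK); rewrite ff gK.
  by congr finterp; apply/funext => k /=; rewrite gK.
- move=> r xs; rewrite -(rf r (g \o xs)).
  by rewrite (_ : f \o (g \o xs) = xs)//; apply/funext => k /=; rewrite gK.
Qed.

Definition aut1 := Aut aut1_subproof.
Definition autM (f g : aut) := Aut (autM_subproof f g).
Definition autV (f : aut) :=
  Aut (let: And3 _ _ gP := projT2 (autV_exists f) in gP).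

Lemma autVK (f : aut) : cancel f (autV f).
Proof. by rewrite /autV /=; case: (autV_exists f) => g []. Qed.

Lemma autKV (f : aut) : cancel (autV f) f.
Proof. by rewrite /autV /=; case: (autV_exists f) => g []. Qed.

Fact autMA : associative autM. Proof. by move=> f g h; exact: aut_eq. Qed.
Fact aut1M : left_id aut1 autM. Proof. by move=> f; exact: aut_eq. Qed.
Fact autM1 : right_id aut1 autM. Proof. by move=> f; exact: aut_eq. Qed.
Fact autVM : left_inverse aut1 autV autM.
Proof. by move=> f; apply: aut_eq => x; exact: autVK. Qed.
Fact autMV : right_inverse aut1 autV autM.
Proof. by move=> f; apply: aut_eq => x; exact: autKV. Qed.

HB.instance Definition _ := isGroup.Build aut autMA aut1M autM1 autVM autMV.

End Automorphism.

Definition is_subgroup (G : groupType) (H : set G) : Prop :=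
  [/\ H 1, (forall x y, H x -> H y -> H (x * y)) & (forall x, H x -> H x^-1)].

Record normal_subgroup (G : groupType) := NormalSubgroup {
  nsubg : set G;
  nsubg_subgroup : is_subgroup nsubg;
  nsubgJ : forall x y, nsubg x -> nsubg (y * x * y^-1) }.

Section QuotientGroup.
Context (G : groupType) (H : normal_subgroup G).

Let H1 : nsubg H 1. Proof. by case: (nsubg_subgroup H). Qed.
Let HM x y : nsubg H x -> nsubg H y -> nsubg H (x * y).
Proof. by case: (nsubg_subgroup H) => _ + _; exact. Qed.
Let HV x : nsubg H x -> nsubg H x^-1.
Proof. by case: (nsubg_subgroup H) => _ _; exact. Qed.

Definition same_coset (x y : G) : bool := `[< nsubg H (x^-1 * y) >].

Fact same_coset_equiv : equiv_class_of same_coset.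
Proof.
split=> [x|x y|y x z].
- by apply/asboolP; rewrite mulVg; exact: H1.
- by apply/asbool_equiv_eq; split=> /HV; rewrite invgM invgK.
- move=> /asboolP xy /asboolP yz; apply/asboolP.
  by rewrite -(mulgK y x^-1) -mulgA; exact: HM.
Qed.

Canonical same_coset_rel := EquivRelPack same_coset_equiv.

Local Open Scope quotient_scope.

Definition quotient_group : Type := {eq_quot same_coset_rel}.

HB.instance Definition _ := EqQuotient.on quotient_group.
HB.instance Definition _ := Choice.on quotient_group.

Definition coset_of (x : G) : quotient_group := \pi_quotient_group x.

Lemma coset_ofP x y : coset_of x = coset_of y <-> nsubg H (x^-1 * y).
Proof.
split=> [/eqP|xy]; first by rewrite /coset_of eqmodE => /asboolP.
by apply/eqP; rewrite /coset_of eqmodE; apply/asboolP.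
Qed.

Definition quot1 : quotient_group := coset_of 1.
Definition quotM (u v : quotient_group) : quotient_group :=
  coset_of (repr u * repr v).
Definition quotV (u : quotient_group) : quotient_group := coset_of (repr u)^-1.

Let coset_repr u : coset_of (repr u) = u. Proof. exact: reprK. Qed.
Let repr_coset x : nsubg H (x^-1 * repr (coset_of x)).
Proof. by apply/coset_ofP; rewrite coset_repr. Qed.

Lemma quotM_coset x y : quotM (coset_of x) (coset_of y) = coset_of (x * y).
Proof.
apply/esym/coset_ofP; move: (repr_coset x) (repr_coset y).
move: (repr (coset_of x)) (repr (coset_of y)) => x' y' hx hy.
have -> : (x * y)^-1 * (x' * y') = (y^-1 * (x^-1 * x') * y) * (y^-1 * y').
  by rewrite invgM !mulgA mulgK.
by apply: HM => //; have := nsubgJ y^-1 hx; rewrite invgK.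
Qed.

Lemma quotV_coset x : quotV (coset_of x) = coset_of x^-1.
Proof.
apply/coset_ofP; move: (repr_coset x); move: (repr _) => x' hx.
rewrite invgK; have /(nsubgJ x) := hx.
by rewrite mulgA mulgV mul1g.
Qed.

Fact quotMA : associative quotM.
Proof.
move=> u v w; rewrite -(coset_repr u) -(coset_repr v) -(coset_repr w).
by rewrite !quotM_coset mulgA.
Qed.

Fact quot1M : left_id quot1 quotM.
Proof. by move=> u; rewrite -(coset_repr u) quotM_coset mul1g. Qed.

Fact quotM1 : right_id quot1 quotM.
Proof. by move=> u; rewrite -(coset_repr u) quotM_coset mulg1. Qed.

Fact quotVM : left_inverse quot1 quotV quotM.
Proof.
by move=> u; rewrite -(coset_repr u) quotV_coset quotM_coset mulVg.
Qed.

Fact quotMV : right_inverse quot1 quotV quotM.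
Proof.
by move=> u; rewrite -(coset_repr u) quotV_coset quotM_coset mulgV.
Qed.

HB.instance Definition _ :=
  isGroup.Build quotient_group quotMA quot1M quotM1 quotVM quotMV.

End QuotientGroup.

#[short(type="preTopologicalGroupType")]
HB.structure Definition PreTopologicalGroup :=
  {G of Topological G & Group G}.

Definition topological_group (G : preTopologicalGroupType) : Prop :=
  continuous (fun p : G * G => p.1 * p.2) /\ continuous (fun x : G => x^-1).

Section Hyperimaginary.
Context (L : language) (S : structure L).

Definition equivalence_relation X (E : X -> X -> Prop) : Prop :=
  [/\ forall x, E x x, forall x y, E x y -> E y x &
      forall x y z, E x y -> E y z -> E x z].

Definition type_definable_rel (I : Type) (E : (I -> S) -> (I -> S) -> Prop) :=
  exists Phi : set (formula L (I + I)), forall b c : I -> S,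
    E b c <-> (forall phi, Phi phi ->
      sat (fun i => match i with inl i => b i | inr i => c i end) phi).

Definition eclass (I : Type) (E : (I -> S) -> (I -> S) -> Prop) (a : I -> S) :
  set (I -> S) := [set b | E a b].

(** A hyperimaginary [a/E] is represented by its class [eclass E a]. *)
Context (I : Type).
Implicit Types (e : set (I -> S)) (M N : set S) (f g : aut S).

Definition aut_act f e : set (I -> S) := (fun b => f \o b) @` e.

Lemma aut_act1 e : aut_act 1 e = e.
Proof. by rewrite /aut_act (_ : (fun b => _) = id) ?image_id. Qed.

Lemma aut_actM f g e : aut_act (f * g) e = aut_act f (aut_act g e).
Proof. by rewrite /aut_act image_comp. Qed.

Definition fixes f e : Prop := aut_act f e = e.

Lemma fixesM f g e : fixes f e -> fixes g e -> fixes (f * g) e.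
Proof. by rewrite /fixes aut_actM => fe ->. Qed.

Lemma fixesV f e : fixes f e -> fixes f^-1 e.
Proof. by move=> fe; rewrite /fixes -{1}fe -aut_actM mulVg aut_act1. Qed.

Definition fixes_pointwise f M : Prop := forall x, M x -> f x = x.

Definition in_dcl e M : Prop := forall f, fixes_pointwise f M -> fixes f e.

Definition aut_over e : Type := {f : aut S | f \in [set f | fixes f e]}.

HB.instance Definition _ e := SubType.on (aut_over e).
HB.instance Definition _ e := [Choice of aut_over e by <:].

Fact aut_over_group_closed e : group_closed (mem [set f | fixes f e]).
Proof.
split=> [|f g]; first by rewrite inE; exact: aut_act1.
by rewrite !inE => fe ge; apply: fixesM => //; exact: fixesV.
Qed.

HB.instance Definition _ e :=
  SubChoice_isSubGroup.Build (aut S) _ (aut_over e) (aut_over_group_closed e).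

End Hyperimaginary.

Definition small_model (K : Type) L (S : structure L) (M : set S) : Prop :=
  small K M /\ elementary_submodel M.

Lemma eval_iso L (S S' : structure L) (h : S -> S') V (v : V -> S) t :
  (forall s xs, h (finterp S s xs) = finterp S' s (h \o xs)) ->
  eval (h \o v) t = h (eval v t).
Proof.
move=> hf; elim: t => [//|s ts IH] /=; rewrite hf.
by congr finterp; apply/funext => k /=.
Qed.

Lemma sat_iso L (S S' : structure L) (h : S -> S') :
  bijective h ->
  (forall s xs, h (finterp S s xs) = finterp S' s (h \o xs)) ->
  (forall r xs, rinterp S' r (h \o xs) <-> rinterp S r xs) ->
  forall V (v : V -> S) (phi : formula L V), sat (h \o v) phi <-> sat v phi.
Proof.
move=> [h' hK h'K] hf hr V v phi.
elim: phi v => {V} [V t u|V r ts|V|V p IHp q IHq|V p IH] v /=.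
- rewrite !(eval_iso v) //; split=> [|-> //]; exact: (can_inj hK).
- rewrite -hr; rewrite (_ : (fun k => _) = h \o (fun k => eval v (ts k))) //.
  by apply/funext => k /=; rewrite eval_iso.
- by [].
- by split=> H /IHp/H/IHq.
- have E x : extend (h \o v) (h x) = h \o extend v x by apply/funext => -[].
  split=> H x; first by move: (H (h x)); rewrite E IH.
  by rewrite -(h'K x) E IH.
Qed.

Lemma small_model_image K L (S : structure L) (f : aut S) (M : set S) :
  small_model K M -> small_model K (f @` M).
Proof.
case: (autP f) => [fbij ff fr] [[MK KM] [M0 [Mcl Mel]]].
have fM : (f @` M #= M)%card by apply: inj_card_eq; apply: in2W; exact: bij_inj.
split; first by split; rewrite ?(card_le_eql fM) ?(card_le_eqr fM).
have fM0 : f @` M !=set0 by case: (M0) => x Mx; exists (f x); exists x.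
have fMcl : fclosed (f @` M).
  move=> s xs xsM; have /choice[ys ysP] : forall k, exists y, M y /\ f y = xs k.
    by move=> k; case: (xsM k) => y; exists y.
  exists (finterp S s ys); first by apply: (Mcl) => k; case: (ysP k).
  by rewrite ff; congr finterp; apply/funext => k /=; case: (ysP k).
exists fM0, fMcl => V w phi.
have fin (x : M) : f (val x) \in f @` M.
  by apply/mem_set; exists (val x) => //; exact: set_valP.
pose h (x : induced M0 Mcl) : induced fM0 fMcl :=
  exist (fun y => y \in f @` M) (f (val x)) (fin x).
have hinj : injective h.
  by move=> x y /(congr1 val) /= /(bij_inj fbij) /val_inj.
have /choice[h' h'K] : forall y, exists x, h x = y.
  move=> [y yM]; have /set_mem[x Mx xy] := yM.
  by exists (exist (fun x => x \in M) x (mem_set Mx)); exact: val_inj.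
have hbij : bijective h by exists h' => // x; apply: hinj.
have hf s xs : h (finterp (induced M0 Mcl) s xs) =
    finterp (induced fM0 fMcl) s (h \o xs) by apply: val_inj; exact: ff.
have hr r xs : rinterp (induced fM0 fMcl) r (h \o xs) <->
    rinterp (induced M0 Mcl) r xs by exact: fr.
have -> : w = h \o (h' \o w) by apply/funext => i /=; rewrite h'K.
by rewrite (sat_iso hbij hf hr) Mel -(sat_iso fbij ff fr).
Qed.

Section LascarGroup.
Context (K : Type) (L : language) (S : structure L) (I : Type).
Context (e : set (I -> S)).
Local Notation Aut_e := (aut_over e).

Definition fixes_model : set Aut_e :=
  [set f | exists M, [/\ small_model K M, in_dcl e M &
                         fixes_pointwise (val f) M]].

Definition autf : set Aut_e := smallest (@is_subgroup Aut_e) fixes_model.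

Lemma fixes_modelJ f g : fixes_model f -> fixes_model (g * f * g^-1).
Proof.
move=> [M [Mm eM fM]]; have /set_mem ge := valP g.
have gK x : (val g)^-1 (val g x) = x by exact: autVK.
exists (val g @` M); split; first exact: small_model_image.
- move=> h hM; have : fixes ((val g)^-1 * h * val g) e.
    by apply: eM => x Mx /=; rewrite (hM (val g x)); [exact: gK|exists x].
  move=> he; have := fixesM (fixesM ge he) (fixesV ge).
  by rewrite !mulgA mulgV mul1g mulgK.
- move=> _ [x Mx <-]; rewrite -[LHS]/(val g (val f ((val g)^-1 (val g x)))).
  by rewrite gK fM.
Qed.

Lemma autf_subgroup : is_subgroup autf.
Proof.
split=> [H [[]]//|x y xH yH H HP|x xH H HP].
- by case: (HP) => -[_ HM _] _; apply: HM; [exact: xH|exact: yH].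
- by case: (HP) => -[_ _ HV] _; apply: HV; exact: xH.
Qed.

Lemma autfJ f g : autf f -> autf (g * f * g^-1).
Proof.
have [a1 aM aV] := autf_subgroup.
have sub : is_subgroup [set f | autf (g * f * g^-1)].
  split=> [|x y /= xH yH|x /= xH]; first by rewrite /= mulg1 mulgV.
  - by have := aM _ _ xH yH; rewrite !mulgA mulgVK.
  - by have := aV _ xH; rewrite !invgM invgK mulgA.
apply: smallest_sub sub _ f => f /= fM.
by apply: sub_gen_smallest; exact: fixes_modelJ.
Qed.

Definition autf_normal : normal_subgroup Aut_e :=
  NormalSubgroup autf_subgroup autfJ.

Definition lascar_group : Type := quotient_group autf_normal.

HB.instance Definition _ := Group.on lascar_group.

Definition lascar_class (f : Aut_e) : lascar_group := coset_of autf_normal f.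

(** [S_M(N)]; the tuple enumerating [M] is the inclusion [val : M -> S], and the
    sort of the set [conjugate_types M N] carries the topology induced by the
    Stone space. *)
Definition conjugate_types (M N : set S) : set (stone M N) :=
  [set p | exists f : Aut_e, p = tp N (val f \o val)].
Arguments conjugate_types : clear implicits.

(** In a monster model, when [M] and [N] are small models with [e] in their
    definable closures, the class does not depend on the automorphism [f]
    chosen such that [p = tp(f(M)/N)]. *)
Definition nu (M N : set S) (p : conjugate_types M N) : lascar_group :=
  lascar_class (projT1 (cid (set_valP p))).

(** The group [lascar_group] with the quotient topology along [nu M N]. *)
Definition lascar_group_top (M N : set S) : Type := lascar_group.

HB.instance Definition _ M N := Group.on (lascar_group_top M N).

Definition lascar_open (M N : set S) (U : set (lascar_group_top M N)) : Prop :=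
  open (@nu M N @^-1` U).

Fact lascar_openT M N : @lascar_open M N setT.
Proof. by rewrite /lascar_open preimage_setT; exact: openT. Qed.

Fact lascar_openI M N : setI_closed (@lascar_open M N).
Proof. by move=> U V oU oV; exact: (openI oU oV). Qed.

Fact lascar_open_bigU M N J (U : J -> set (lascar_group_top M N)) :
  (forall j, @lascar_open M N (U j)) -> @lascar_open M N (\bigcup_j U j).
Proof.
move=> oU; rewrite /lascar_open preimage_bigcup.
by apply: bigcup_open => j _; exact: oU.
Qed.

HB.instance Definition _ M N := isOpenTopological.Build (lascar_group_top M N)
  (@lascar_openT M N) (@lascar_openI M N) (@lascar_open_bigU M N).

End LascarGroup.
Arguments lascar_group_top K {L S I} e M N.
Arguments lascar_group K {L S I} e.
Arguments conjugate_types {L S I} e M N.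

(* Main.v *)
From HB Require Import structures.
From Stdlib Require List.
Require Import Defs.
From mathcomp Require Import all_boot all_classical topology.

(** Everything rests on one compactness statement, [joint_limit]: along an
    ultrafilter, two families of automorphisms fixing the hyperimaginary [e] have
    limits [g1] and [g2], again fixing [e], such that the type of the pair of
    conjugates of any small tuple [q], over [q] itself, is the limit of the types
    along the family.  It follows from saturation for infinite tuples
    ([realize_tuple]) and strong homogeneity, and it keeps [e] fixed because the
    condition [E a (f a)] is type-definable.

    Through [nu], an automorphism is seen only by the type of its conjugate of [M]
    over [N], and that type determines its Lascar class ([lascar_class_eq]).  A
    set of classes is therefore closed exactly when it is closed under limits of
    types of conjugates along ultrafilters.  Two facts about these limits matter.
    Every family has one, so the group is quasi-compact.  And if [f1] and [f2] tend
    to [g1] and [g2], then [f1^-1 * f2] tends to [g1^-1 * g2] up to [autf], because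
    the type of [f1^-1 * f2 (M)] over [N] is the type of [f2 (M)] over [f1 (N)].
    Inversion and the translations are thus continuous, but joint continuity of
    multiplication needs more, since a product of quotient maps need not be a
    quotient map.

    The remedy is the closure [H] of the identity.  It is a closed normal subgroup,
    and every closed set is a union of cosets of [H].  Using compactness once more,
    a topological limit and a limit of types of the same family agree modulo [H]
    ([cvg_conv]); this is the Hausdorff property of the quotient by [H].  Now let
    [x] and [y] converge topologically to [x0] and [y0] with all products [x * y] in
    a closed set [C].  Their limits of types are [x0] and [y0] modulo [H], the
    product of these limits lies in [C], and hence so does [x0 * y0]. *)

Set Implicit Arguments.
Unset Strict Implicit.
Unset Printing Implicit Defensive.

Local Open Scope classical_set_scope.

(** * Cardinal arithmetic *)

Lemma card_le_injP (A B : Type) :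
  ([set: A] #<= [set: B])%card <-> exists f : A -> B, injective f.
Proof.
split=> [/card_leP[f]|[f f_inj]].
  exists (fun x => val (f (SigSub (mem_set (I : [set: A] x))))) => x y.
  move=> /val_inj /(@inj _ _ _ f); rewrite !inE.
  by move=> /(_ Logic.I Logic.I) [].
have /card_eqPle[_] : (f @` [set: A] #= [set: A])%card.
  by apply: inj_card_eq => x y _ _ /f_inj.
by move=> /card_le_trans; apply; exact: card_leT.
Qed.

(** A maximal partial matching between [A] and [B] exhausts one of them. *)
Lemma card_le_total (A B : Type) :
  ([set: A] #<= [set: B])%card \/ ([set: B] #<= [set: A])%card.
Proof.
pose matching (R : set (A * B)) := forall x y, R x -> R y ->
  (x.1 = y.1 <-> x.2 = y.2).
have [F Fm Ft|R [Rm Rmax]] := @Zorn_bigcup _ matching.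
  move=> x y [X FX Xx] [Y FY Yy].
  by case: (Ft _ _ FX FY) => sub; [apply: (Fm _ FY)|apply: (Fm _ FX)] => //;
    apply: sub.
have [domR|/existsNP[a aR]] := pselect (forall a, exists b, R (a, b)).
  left; apply/card_le_injP; have [f fR] := choice domR.
  by exists f => x y fxy; apply/(Rm _ _ (fR x) (fR y)).
have [ranR|/existsNP[b bR]] := pselect (forall b, exists a, R (a, b)).
  right; apply/card_le_injP; have [f fR] := choice ranR.
  by exists f => x y fxy; apply/(Rm _ _ (fR x) (fR y)).
case: (Rmax ((a, b) |` R)).
  split=> [|sub]; first by move=> x Rx; right.
  by apply: aR; exists b; apply: sub; left.
have fresh x : R x -> x.1 <> a /\ x.2 <> b.
  by case: x => x y Rx; split=> /= xE; [apply: aR|apply: bR];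
    [exists y|exists x]; rewrite -xE.
move=> x y [->|Rx] [->|Ry] //=; last exact: Rm.
- by have [n1 n2] := fresh _ Ry; split=> [/esym/n1|/esym/n2].
- by have [n1 n2] := fresh _ Rx; split=> [/n1|/n2].
Qed.

(** Doubling an infinite cardinal: a maximal family of disjoint copies of [nat]
    in [B] leaves only finitely many points uncovered.  These are absorbed by one
    of the copies, so that [B] embeds into a disjoint union of copies of [nat],
    and each copy has room for two. *)
Lemma card_double (B : Type) : infinite_set [set: B] ->
  exists h : bool -> B -> B, forall i j x y, h i x = h j y -> i = j /\ x = y.
Proof.
move=> Binf.
pose disjoint (F : set (nat -> B)) := forall f g m n, F f -> F g ->
  f m = g n -> f = g /\ m = n.
have [G Gd Gt|F [Fd Fmax]] := @Zorn_bigcup _ disjoint.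
  move=> f g m n [X GX Xf] [Y GY Yg].
  by case: (Gt _ _ GX GY) => sub; [apply: (Gd _ GY)|apply: (Gd _ GX)] => //;
    apply: sub.
pose R := [set x | forall f n, F f -> f n <> x].
have Rfin : finite_set R.
  apply: contrapT => /infiniteP/card_leP[s].
  pose f n : B := val (s (SigSub (mem_set (I : [set: nat] n)))).
  have f_inj : injective f.
    move=> x y /val_inj /(@inj _ _ _ s); rewrite !inE.
    by move=> /(_ Logic.I Logic.I) [].
  have fR n : R (f n) by exact: set_valP.
  case: (Fmax (f |` F)).
    split=> [|sub]; first by move=> x Fx; right.
    by apply: (fR 0%N f 0%N) => //; apply: sub; left.
  move=> g h m n [->|Fg] [->|Fh]; last exact: Fd.
  - by move=> /f_inj ->.
  - by move=> /esym/(fR m _ _ Fh).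
  - by move=> /(fR n _ _ Fg).
have [f0 Ff0] : exists f0, F f0.
  apply: contrapT => /forallNP F0; apply: Binf.
  by rewrite (_ : setT = R) //; apply/seteqP; split=> // x _ f n /F0.
have [k /card_eqPle[Rk _]] := Rfin.
have [idx idx_inj idx_lt] : exists2 idx : B -> nat,
    (forall x y, R x -> R y -> idx x = idx y -> x = y) &
    (forall x, R x -> (idx x < k)%N).
  have /pcard_leP[s] := Rk; exists s => [x y Rx Ry|x Rx].
    by apply: (@inj _ _ _ s); exact: mem_set.
  exact: (@funS _ _ _ _ s).
(* A covered point [f n] is moved to [(f, n + k)], which frees the places
   [(f0, i)] with [i < k] for the uncovered points. *)
have /choice[code codeP] : forall x, exists c : (nat -> B) * nat,
    F c.1 /\ ((k <= c.2)%N /\ c.1 (c.2 - k) = x \/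
              [/\ R x, c.1 = f0 & c.2 = idx x]).
  move=> x; have [Rx|] := pselect (R x).
    by exists (f0, idx x); split=> //; right.
  move=> /existsNP[f /existsNP[n /not_implyP[Ff /contrapT fn]]].
  by exists (f, n + k)%N; split=> //; left; rewrite leq_addl addnK.
have code_inj x y : code x = code y -> x = y.
  move=> xy; have [_] := codeP x; have [_] := codeP y; rewrite xy.
  case=> [[ky yE]|[Ry _ cy]]; case=> [[kx xE]|[Rx _ cx]].
  - by rewrite -xE yE.
  - by have := idx_lt _ Rx; rewrite -cx ltnNge ky.
  - by have := idx_lt _ Ry; rewrite -cy ltnNge kx.
  - by apply: idx_inj => //; rewrite -cx -cy.
exists (fun i x => (code x).1 ((code x).2.*2 + i)%N) => i j x y.
move=> /(Fd _ _ _ _ (codeP x).1 (codeP y).1)[c1 c2].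
have ij : i = j by move: (congr1 odd c2); rewrite !oddD !odd_double !oddb.
split=> //; apply: code_inj; move: c2; rewrite ij => /addIn/double_inj.
by move: c1; case: (code x) (code y) => [? ?] [? ?] /= -> ->.
Qed.

(** Strictly below an infinite cardinal, a sum is finite or is bounded by twice
    the larger summand. *)
Lemma small_sum (K A B : Type) : infinite_set [set: K] ->
  small K [set: A] -> small K [set: B] -> small K [set: A + B].
Proof.
move=> Kinf.
wlog: A B / ([set: A] #<= [set: B])%card.
  move=> wl sA sB; have [AB|BA] := card_le_total A B; first exact: wl.
  have [] := wl B A BA sB sA.
  have swap (X Y : Type) : ([set: X + Y] #<= [set: Y + X])%card.
    apply/card_le_injP.
    exists (fun i => match i with inl x => inr x | inr x => inl x end).
    by move=> [x|x] [y|y] //= [->].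
  move=> BAK KBA; split; first exact: card_le_trans (swap _ _) BAK.
  by move=> KAB; apply: KBA; exact: card_le_trans KAB (swap _ _).
move=> AB [_ _] [BK KB].
have [Bfin|Binf] := pselect (finite_set [set: B]).
  have ABfin : finite_set [set: A + B].
    have -> : [set: A + B] = inl @` [set: A] `|` inr @` [set: B].
      by apply/seteqP; split=> // -[x|x] _; [left|right]; exists x.
    rewrite finite_setU; split; apply: finite_image => //.
    exact: card_le_finite AB Bfin.
  split; last by move=> /card_le_finite/(_ ABfin).
  have [n /card_eqPle[ABn _]] := ABfin.
  apply: card_le_trans ABn _; apply: card_le_trans (card_leT _) _.
  exact/infiniteP.
have [h h_inj] := card_double Binf.
suff ABB : ([set: A + B] #<= [set: B])%card.
  split; first exact: card_le_trans ABB BK.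
  by move=> KAB; apply: KB; exact: card_le_trans KAB ABB.
have [f f_inj] := (card_le_injP A B).1 AB; apply/card_le_injP.
exists (fun i => match i with inl x => h true (f x) | inr y => h false y end).
by move=> [x|x] [y|y] /h_inj[] // _; [move=> /f_inj ->|move=> ->].
Qed.

Lemma small_set_type K T (A : set T) : small K [set: A] <-> small K A.
Proof.
have AT := card_setT A.
by rewrite /small (card_le_eql AT) (card_le_eqr AT).
Qed.

Lemma small_le K T U (A : set T) (B : set U) :
  (A #<= B)%card -> small K B -> small K A.
Proof.
move=> AB [BK KB]; split; first exact: card_le_trans AB BK.
by move=> KA; apply: KB; exact: card_le_trans KA AB.
Qed.

(** * Renaming, support and elimination of variables *)

Definition glue V W X (v : V -> X) (w : W -> X) (i : V + W) : X :=
  match i with inl j => v j | inr j => w j end.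

Section Formulas.
Context (L : language) (S : structure L).

Fixpoint trename V W (s : V -> W) (t : term L V) : term L W :=
  match t with
  | Var i => Var L (s i)
  | App f ts => App (fun k => trename s (ts k))
  end.

Fixpoint rename V W (s : V -> W) (phi : formula L V) : formula L W :=
  match phi with
  | Eqn t u => Eqn (trename s t) (trename s u)
  | Rel r ts => Rel (fun k => trename s (ts k))
  | Bot => Bot
  | Imp phi psi => Imp (rename s phi) (rename s psi)
  | All phi => All (rename (omap s) phi)
  end.

Lemma eval_rename V W (s : V -> W) (w : W -> S) t :
  Defs.eval w (trename s t) = Defs.eval (w \o s) t.
Proof.
by elim: t => //= f ts IH; congr finterp; apply/funext => k.
Qed.

Lemma sat_rename V W (s : V -> W) (w : W -> S) phi :
  sat w (rename s phi) <-> sat (w \o s) phi.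
Proof.
elim: phi W s w => {V} [V t u|V r ts|V|V p IHp q IHq|V p IH] W s w //=.
- by rewrite !eval_rename.
- by under [X in rinterp _ _ X]eq_fun do rewrite eval_rename.
- by split=> H /IHp/H/IHq.
- have extE x : extend w x \o omap s = extend (w \o s) x by apply/funext => -[].
  by split=> H x; move: (H x); rewrite IH extE.
Qed.

Lemma sat_neg V (v : V -> S) phi : sat v (Neg phi) <-> ~ sat v phi.
Proof. by []. Qed.

Lemma conjunction V (F : set (formula L V)) : finite_set F ->
  exists phi : formula L V, forall v : V -> S,
    sat v phi <-> forall psi, F psi -> sat v psi.
Proof.
move=> /finite_seqP[l ->]; elim: l => [|psi l [phi phiP]].
  by exists (Neg Bot) => v; split=> [_ psi|_] //=; rewrite in_nil.
exists (Neg (Imp psi (Neg phi))) => v.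
rewrite sat_neg /= not_implyP notK phiP; split=> [[v1 v2] chi|H].
  by rewrite /= inE => /orP[/eqP->|/v2].
by split=> [|chi lchi]; apply: H; rewrite /= inE ?eqxx // lchi orbT.
Qed.

(** Finite sets of variables are lists and membership is [List.In], since the type
    of variables need not have decidable equality. *)
Definition agree V (s : seq V) (v w : V -> S) : Prop :=
  forall i, List.In i s -> v i = w i.

Lemma seq_bound V n (f : 'I_n -> seq V) :
  exists s, forall k i, List.In i (f k) -> List.In i s.
Proof.
exists (flatten [seq f k | k <- enum 'I_n]) => k i.
have : k \in enum 'I_n by rewrite mem_enum.
elim: (enum 'I_n) => //= j l IH; rewrite inE List.in_app_iff.
by move=> /orP[/eqP->|/IH kl]; [left|right; exact: kl].
Qed.

Lemma term_support V (t : term L V) :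
  exists s, forall v w : V -> S, agree s v w -> Defs.eval v t = Defs.eval w t.
Proof.
elim: t => [i|f ts /choice[s sP]].
  by exists [:: i] => v w; apply; left.
have [s' s'P] := seq_bound s; exists s' => v w vw /=.
by congr finterp; apply/funext => k; apply: sP => i /s'P/vw.
Qed.

Lemma formula_support V (phi : formula L V) :
  exists s, forall v w : V -> S, agree s v w -> (sat v phi <-> sat w phi).
Proof.
elim: phi => {V} [V t u|V r ts|V|V p [sp IHp] q [sq IHq]|V p [s IH]].
- have [[st stP] [su suP]] := (term_support t, term_support u).
  exists (st ++ su) => v w vw /=.
  by rewrite (stP v w) ?(suP v w) // => i ?; apply: vw; apply/List.in_app_iff; tauto.
- have /choice[s sP] := fun k => term_support (ts k).
  have [s' s'P] := seq_bound s; exists s' => v w vw /=.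
  suff -> : (fun k => Defs.eval v (ts k)) = (fun k => Defs.eval w (ts k)) by [].
  by apply/funext => k; apply: sP => i /s'P/vw.
- by exists [::].
- exists (sp ++ sq) => v w vw /=.
  rewrite (IHp v w) 1?(IHq v w) // => i ?; apply: vw; apply/List.in_app_iff; tauto.
- exists (pmap id s) => v w vw /=.
  suff H x : sat (extend v x) p <-> sat (extend w x) p by split=> Hp x; apply/H.
  apply: IH => -[i|] //= si; apply: vw.
  by elim: s si => //= o s IHs [->|/IHs]; [left|case: o => //= j; right].
Qed.

(** Only the variables in the support matter, so finitely many quantifiers
    suffice; [i0] replaces the eliminated variables, which are vacuous by then. *)
Lemma exists_block W V (i0 : V) (phi : formula L (W + V)) :
  exists psi : formula L V, forall v : V -> S,
    sat v psi <-> exists w : W -> S, sat (glue w v) phi.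
Proof.
have [s sP] := formula_support phi.
have [l lP] : exists l, forall i, List.In (inl i) s -> List.In i l.
  exists (pmap (fun j => if j is inl i then Some i else None) s) => i.
  elim: (s) => //= -[j|j] l IH [jE|/IH] //=; last by right.
  by left; case: jE.
(* The quantified block is first restricted to the variables in [l], which can be
   handled one at a time. *)
have [psi psiP] : exists psi : formula L (W + V),
    forall (w : W -> S) (v : V -> S),
    sat (glue w v) psi <->
    exists2 w', (forall i, ~ List.In i l -> w' i = w i) & sat (glue w' v) phi.
  elim: l {lP} => [|i l [psi psiP]].
    exists phi => w v; split=> [|[w' w'E]]; first by exists w.
    by rewrite (_ : w' = w) //; apply/funext => i; exact: w'E.
  pose sigma (j : W + V) : option (W + V) :=
    if j is inl k then if `[< k = i >] then None else Some j else Some j.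
  pose upd (w : W -> S) x k := if `[< k = i >] then x else w k.
  have updE w v x : extend (glue w v) x \o sigma = glue (upd w x) v.
    by apply/funext => -[k|k] //=; rewrite /upd; case: asboolP.
  exists (Neg (All (rename sigma (Neg psi)))) => w v.
  rewrite sat_neg /= -existsNE; split.
    move=> [x]; rewrite notK sat_rename updE psiP => -[w' w'E phiw'].
    exists w' => // k /not_orP[ki kl]; rewrite w'E // /upd.
    by case: asboolP => // /esym.
  move=> [w' w'E phiw']; exists (w' i).
  rewrite notK sat_rename updE psiP; exists w' => // k kl.
  rewrite /upd; case: asboolP => [->//|ki]; apply: w'E => -[/esym|] //.
exists (rename (glue (fun=> i0) id) psi) => v.
rewrite sat_rename (_ : _ \o _ = glue (fun=> v i0) v); last first.
  by apply/funext => -[].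
rewrite psiP; split=> [[w _]|[w phiw]]; first by exists w.
pose w' i := if `[< List.In i l >] then w i else v i0.
exists w' => [i il|]; first by rewrite /w'; case: asboolP.
suff /sP -> : agree s (glue w' v) (glue w v) by [].
by move=> -[i|i] //= /lP il; rewrite /w'; case: asboolP.
Qed.

End Formulas.

(** * Saturation for infinite tuples *)

Section Saturation.
Context (K : Type) (L : language) (S : structure L).
Hypotheses (K_infinite : infinite_set [set: K]) (S_sat : saturated K S).
Context (X : Type) (A : set S) (p : set (formula L (X + A))).
Hypotheses (X_small : small K [set: X]) (A_small : small K A).
Hypothesis (p_fs : finitely_satisfiable p).

(** A partial realization is a graph rather than a function on a subset: being
    single-valued then follows from the case [F = set0], and unions of chains of
    graphs need no gluing. *)
Let partial_realization (R : set (X * S)) : Prop :=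
  forall F, finite_set F -> F `<=` p -> exists b : X -> S,
    (forall x s, R (x, s) -> b x = s) /\ forall phi, F phi -> sat (assign b) phi.

Let realization_functional R x s s' : partial_realization R ->
  R (x, s) -> R (x, s') -> s = s'.
Proof.
move=> /(_ set0 (finite_set0 _) (fun _ => False_ind _))[b [bR _]].
by move=> /bR <- /bR.
Qed.

(** A finite part of [p] mentions finitely many variables, which a single member
    of the chain treats as the union does. *)
Let realization_bigcup (C : set (set (X * S))) :
  C `<=` partial_realization -> total_on C subset ->
  partial_realization (\bigcup_(R in C) R).
Proof.
move=> Cp Ct F Ffin Fp.
have [[R0 CR0]|C0] := pselect (C !=set0); last first.
  have [b bF] := p_fs Ffin Fp; exists b; split=> // x s [R CR].
  by case: C0; exists R.
set U := \bigcup_(R in C) R.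
have Ufun x s s' : U (x, s) -> U (x, s') -> s = s'.
  move=> [R CR Rs] [R' CR' Rs'].
  case: (Ct _ _ CR CR') => sub.
  - exact: realization_functional (Cp _ CR') (sub _ Rs) Rs'.
  - exact: realization_functional (Cp _ CR) Rs (sub _ Rs').
have [phi phiF] := conjunction S Ffin.
have [s sP] := formula_support S phi.
have [R CR RU] : exists2 R, C R &
    forall i, List.In i s -> forall x y, i = inl x -> U (x, y) -> R (x, y).
  elim: (s) => [|i l [R CR RU]]; first by exists R0.
  have [[[x y] [ix [R1 CR1 R1xy]]]|iU] :=
    pselect (exists xy, i = inl xy.1 /\ U xy); last first.
    by exists R => // j [<-|/RU//] x y ix Uxy; case: iU; exists (x, y).
  have [R2 [CR2 RR2 R12]] : exists R2, [/\ C R2, R `<=` R2 & R1 `<=` R2].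
    by case: (Ct _ _ CR CR1) => sub; [exists R1|exists R]; split=> // ?.
  exists R2 => // j [<-|jl] x' y' jx Ux'y'; last exact/RR2/(RU _ jl).
  move: jx Ux'y'; rewrite ix => -[/= <-] Uxy'; apply: R12.
  by rewrite -(Ufun x y y') //; exists R1.
have [b0 [b0R b0F]] := Cp _ CR _ Ffin Fp.
have /choice[b bP] : forall x, exists y, (forall y', U (x, y') -> y = y') /\
    ((forall y', ~ U (x, y')) -> y = b0 x).
  move=> x; have [[y Uxy]|nU] := pselect (exists y, U (x, y)).
    by exists y; split=> [y' /(Ufun _ _ _ Uxy)//|/(_ y)//].
  by exists (b0 x); split=> // y Uxy; case: nU; exists y.
exists b; split=> [x y|]; first exact: (bP x).1.
apply/phiF; have /phiF := b0F; apply: (sP _ _ _).1 => -[x|//] xs /=.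
have [[y Uxy]|nU] := pselect (exists y, U (x, y)).
  by rewrite ((bP x).1 _ Uxy) (b0R x y) //; exact: (RU _ xs _ _ erefl Uxy).
by rewrite (bP x).2 // => y Uxy; apply: nU; exists y.
Qed.

(** The possible values at [x0] are described by a type in one variable over [A]
    and the values already chosen, in which the variables without a value are
    existentially quantified. *)
Let realization_extend R x0 : partial_realization R ->
  (forall s, ~ R (x0, s)) -> exists s, partial_realization ((x0, s) |` R).
Proof.
move=> Rp x0R.
have [r [rR _]] := Rp set0 (finite_set0 _) (fun _ => False_ind _).
pose A' := A `|` range r.
have A'_small : small K A'.
  have -> : A' = range (glue (val : A -> S) r).
    apply/seteqP; split=> [x [Ax|[y _ <-]]|_ [[x|x] _ <-]].
    - by exists (inl (SigSub (mem_set Ax))).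
    - by exists (inr y).
    - by left; exact: set_valP.
    - by right; exists x.
  apply: small_le (card_image_le _ _) _.
  by apply: small_sum => //; exact/small_set_type.
have AA' (x : A) : val x \in A' by apply/mem_set; left; exact: set_valP.
have rA' x : r x \in A' by apply/mem_set; right; exists x.
pose inA (x : A) : A' := SigSub (AA' x).
pose inr' (x : X) : A' := SigSub (rA' x).
pose dom x := exists s, R (x, s).
pose sigma (i : X + A) : X + (unit + A') :=
  match i with
  | inl x => if `[< dom x >] then inr (inr (inr' x)) else
             if `[< x = x0 >] then inr (inl tt) else inl x
  | inr a => inr (inr (inA a))
  end.
pose b w (c : unit -> S) x :=
  if `[< dom x >] then r x else if `[< x = x0 >] then c tt else w x.
have sigmaE w c : glue w (assign c) \o sigma = assign (b w c).
  by apply/funext => -[x|x] //=; rewrite /b; do 2! [case: asboolP => //= _].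
pose conj_of F (phi : formula L (X + A)) := forall v : X + A -> S,
  sat v phi <-> forall chi, F chi -> sat v chi.
pose projects (phi : formula L (X + A)) (psi : formula L (unit + A')) :=
  forall v : unit + A' -> S,
  sat v psi <-> exists w : X -> S, sat (glue w v) (rename sigma phi).
pose q := [set psi | exists F, [/\ finite_set F, F `<=` p &
  exists2 phi, conj_of F phi & projects phi psi]].
have q_fs : finitely_satisfiable q.
  move=> G Gfin Gq.
  have /choice[F FP] : forall psi, exists F, G psi ->
      [/\ finite_set F, F `<=` p & exists2 phi, conj_of F phi & projects phi psi].
    move=> psi; have [/Gq[F FP]|nG] := pselect (G psi); first by exists F.
    by exists set0.
  have [||w [wR wF]] := Rp (\bigcup_(psi in G) F psi).
  - by apply: bigcup_finite => // psi /FP[].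
  - by move=> chi [psi /FP[_ + _]]; apply.
  exists (fun=> w x0) => psi Gpsi; have [_ _ [phi phiF ->]] := FP _ Gpsi.
  exists w; rewrite sat_rename sigmaE.
  rewrite (_ : b _ _ = w); first by apply/phiF => chi Fchi; apply: wF; exists psi.
  apply/funext => x; rewrite /b; case: asboolP => [[s Rxs]|_].
    by rewrite (rR _ _ Rxs) (wR _ _ Rxs).
  by case: asboolP => // ->.
have [c cq] := S_sat A'_small q_fs.
exists (c tt) => F Ffin Fp.
have [phi phiF] := conjunction S Ffin.
have [psi psiP] := exists_block S (inl tt) (rename sigma phi).
have /cq/psiP[w] : q psi by exists F; split=> //; exists phi.
rewrite sat_rename sigmaE => phiw; exists (b w c); split; last exact/phiF.
move=> x s [[-> ->]|Rxs]; rewrite /b.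
  by case: asboolP => [[s' /x0R]//|_]; case: asboolP.
by case: asboolP => [_|[]]; [exact: rR|exists s].
Qed.

Lemma realize_tuple : exists b : X -> S, forall phi, p phi -> sat (assign b) phi.
Proof.
have [R [Rp Rmax]] := Zorn_bigcup realization_bigcup.
have /choice[b bR] : forall x, exists s, R (x, s).
  move=> x; apply: contrapT => /forallNP xR.
  have [s Rs] := realization_extend Rp xR; apply: Rmax Rs.
  split=> [|sub]; first by move=> ? ?; right.
  by apply: (xR s); apply: sub; left.
exists b => phi pphi.
have [||b' [b'R b'phi]] := Rp [set phi].
- exact: finite_set1.
- by move=> _ ->.
by rewrite (_ : b = b'); [exact: b'phi|apply/funext => x; rewrite (b'R _ _ (bR x))].
Qed.

End Saturation.

(** * Limits of automorphisms *)

Local Open Scope group_scope.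

Section Automorphisms.
Context (L : language) (S : structure L).

Lemma sat_aut (g : aut S) V (v : V -> S) (phi : formula L V) :
  sat (g \o v) phi <-> sat v phi.
Proof. by case: (autP g) => bg fg rg; exact: sat_iso. Qed.

Context (I : Type) (E : (I -> S) -> (I -> S) -> Prop) (a : I -> S).
Hypotheses (E_equiv : equivalence_relation E) (E_typedef : type_definable_rel E).

Lemma type_definable_aut (g : aut S) b c : E (g \o b) (g \o c) <-> E b c.
Proof.
have [Phi PhiP] := E_typedef; rewrite !PhiP.
have catE : glue (g \o b) (g \o c) = g \o glue b c by apply/funext => -[].
split=> H phi /H; first by move: (sat_aut g (glue b c) phi) => [+ _]; rewrite -catE.
by move: (sat_aut g (glue b c) phi) => [_ +]; rewrite -catE.
Qed.

Lemma fixes_eclass (g : aut S) : fixes g (eclass E a) <-> E a (g \o a).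
Proof.
have [Er Es Et] := E_equiv; split=> [ge|Eag].
  have : aut_act g (eclass E a) (g \o a) by exists a => //; exact: Er.
  by rewrite ge.
apply/seteqP; split=> [_ [b Eab <-]|c Eac].
  by apply: Et Eag _; exact/type_definable_aut.
have cE : g \o (autV g \o c) = c by apply/funext => i; exact: autKV.
exists (autV g \o c) => //; apply/(type_definable_aut g); rewrite cE.
exact: Et (Es _ _ Eag) Eac.
Qed.

Lemma aut_over_lift (e : set (I -> S)) (g : aut S) :
  fixes g e -> exists g' : aut_over e, val g' = g.
Proof.
move=> ge; have ge' : g \in [set f | fixes f e] by exact: mem_set.
by exists (exist (fun f : aut S => f \in [set f | fixes f e]) g ge').
Qed.

End Automorphisms.

Section Limits.
Context (K : Type) (L : language) (S : structure L).
Hypotheses (K_infinite : infinite_set [set: K]) (S_sat : saturated K S)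
  (S_hom : strongly_homogeneous K S).
Context (I : Type) (E : (I -> S) -> (I -> S) -> Prop) (a : I -> S).
Hypotheses (I_small : small K [set: I]) (E_equiv : equivalence_relation E)
  (E_typedef : type_definable_rel E).
Local Notation e := (eclass E a).
Local Notation Aut_e := (aut_over e).

(** Compactness of the space of pairs of automorphisms, before any quotient: the
    limit type of [(f1 z q, f2 z q)] over [q] is realized by saturation, and each
    half of a realization has the type of [q], hence is a conjugate of [q] by
    homogeneity.  Adjoining [a] to [q] carries the condition [E a (f z a)] to the
    limit, so that the conjugating automorphisms fix the class of [a]. *)
Lemma joint_limit (J : Type) (q : J -> S) (Z : Type) (U : set_system Z)
    (f1 f2 : Z -> Aut_e) : small K [set: J] -> UltraFilter U ->
  exists g1 g2 : Aut_e, forall phi : formula L ((J + J) + J),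
    sat (glue (glue (val g1 \o q) (val g2 \o q)) q) phi <->
    U [set z | sat (glue (glue (val (f1 z) \o q) (val (f2 z) \o q)) q) phi].
Proof.
move=> J_small U_ultra.
pose J' := (J + I)%type; pose q' : J' -> S := glue q a.
have J'_small : small K [set: J'] by exact: small_sum.
pose A := range q'.
have A_small : small K A by apply: small_le (card_image_le _ _) J'_small.
have qA j : q' j \in A by apply/mem_set; exists j.
pose par (j : J') : A := SigSub (qA j).
pose v z := assign (A := A) (glue (val (f1 z) \o q') (val (f2 z) \o q')).
pose p := [set phi | U [set z | sat (v z) phi]].
have p_fs : finitely_satisfiable p.
  move=> F Ffin Fp; have [phi phiF] := conjunction S Ffin.
  have /finite_seqP[l lF] := Ffin.
  have /filter_ex[z zF] : U [set z | forall phi, F phi -> sat (v z) phi].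
    rewrite lF in Fp *; elim: l {lF phiF Ffin F} Fp => [|psi l IH] Fp.
      by apply: filterS filterT => z _ psi; rewrite /= in_nil.
    have H1 : U [set z | sat (v z) psi] by apply: Fp; rewrite /= inE eqxx.
    apply: filterS2 H1 (IH _) => [z z1 z2 chi /=|chi /= chil].
      by rewrite inE => /orP[/eqP->|/z2].
    by apply: Fp; rewrite /= inE chil orbT.
  by exists (glue (val (f1 z) \o q') (val (f2 z) \o q')).
have X_small : small K [set: J' + J'] by exact: small_sum.
have [b bp] := realize_tuple K_infinite S_sat X_small A_small p_fs.
have bP phi : sat (assign b) phi <-> p phi.
  split=> [bphi|/bp//].
  have [//|nphi] := in_ultra_setVsetC [set z | sat (v z) phi] U_ultra.
  by have /(_ bphi) := bp (Neg phi) nphi.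
(* Each half of [b] is a conjugate of [q'], by an automorphism that moves [a]
   inside its class. *)
have conj (side : J' -> J' + J') (f : Z -> Aut_e) :
    (forall z, glue (val (f1 z) \o q') (val (f2 z) \o q') \o side =
       val (f z) \o q') ->
    exists g : Aut_e, val g \o q' = b \o side.
  move=> sideE.
  have vE z : v z \o (inl \o side) = val (f z) \o q' by rewrite -sideE.
  have [|g0 g0_aut g0E] := S_hom J'_small (b := q') (c := b \o side).
    move=> phi; have : p (rename (inl \o side) phi) <-> sat q' phi.
      rewrite /p /=; split=> [/filter_ex[z]|qphi].
        by rewrite /= sat_rename vE sat_aut.
      apply: filterS filterT => z _.
      by rewrite /= sat_rename vE sat_aut.
    by rewrite -bP sat_rename => <-.
  pose g1 := Aut g0_aut.
  have g1e : fixes g1 e.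
    apply/(fixes_eclass a E_equiv E_typedef).
    have [Phi PhiP] := E_typedef; apply/PhiP => phi Phiphi.
    pose s (i : I + I) : (J' + J') + A :=
      match i with inl i => inr (par (inr i)) | inr i => inl (side (inr i)) end.
    have : p (rename s phi).
      rewrite /p /=; apply: filterS filterT => z _; rewrite /= sat_rename.
      have /(fixes_eclass a E_equiv E_typedef) := set_mem (valP (f z)).
      move=> /PhiP/(_ _ Phiphi); congr sat.
      apply/funext => -[i|i] //=.
      by have := congr1 (fun h => h (inr i)) (sideE z).
    rewrite -bP sat_rename; congr sat; apply/funext => -[i|i] //=.
    by have := congr1 (fun h => h (inr i)) g0E.
  by have [g gE] := aut_over_lift g1e; exists g; rewrite gE.
have [g1 g1E] := conj inl f1 (fun _ => erefl).
have [g2 g2E] := conj inr f2 (fun _ => erefl).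
exists g1, g2 => phi.
pose s (i : (J + J) + J) : (J' + J') + A :=
  match i with
  | inl (inl j) => inl (inl (inl j)) | inl (inr j) => inl (inr (inl j))
  | inr j => inr (par (inl j))
  end.
have <- : p (rename s phi) <->
    U [set z | sat (glue (glue (val (f1 z) \o q) (val (f2 z) \o q)) q) phi].
  rewrite /p /= (_ : [set z | _] = [set z |
    sat (glue (glue (val (f1 z) \o q) (val (f2 z) \o q)) q) phi]) //.
  apply/seteqP; split=> z /=; rewrite sat_rename; congr sat;
    by apply/funext => -[[]|].
rewrite -bP sat_rename (_ : assign b \o s =
  glue (glue (val g1 \o q) (val g2 \o q)) q) //.
apply/funext => -[[j|j]|j] //=.
  by have := congr1 (fun h => h (inl j)) g1E.
by have := congr1 (fun h => h (inl j)) g2E.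
Qed.

Context (M N : set S).
Hypotheses (M_model : small_model K M) (N_model : small_model K N)
  (dcl_M : in_dcl e M) (dcl_N : in_dcl e N).

Definition conjugate (f : Aut_e) : M + N -> S := assign (val f \o val).

(** Two conjugations of [M] with the same type over [N] differ by an automorphism
    over [N] followed by one over [M], and both lie in [autf]. *)
Lemma lascar_class_eq (f g : Aut_e) :
  (forall phi, sat (conjugate f) phi <-> sat (conjugate g) phi) ->
  lascar_class K f = lascar_class K g.
Proof.
move=> fg.
have MN_small : small K [set: M + N].
  by apply: small_sum => //; apply/small_set_type; [case: M_model|case: N_model].
have [h0 h0_aut h0E] := S_hom MN_small fg.
have hN : fixes_pointwise (Aut h0_aut) N.
  by move=> x Nx; have := congr1 (fun h => h (inr (SigSub (mem_set Nx)))) h0E.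
have [h hE] := aut_over_lift (dcl_N hN).
have hM x : M x -> val (g^-1 * h * f)%g x = x.
  move=> Mx; have := congr1 (fun h => h (inl (SigSub (mem_set Mx)))) h0E.
  rewrite /= /conjugate /= => hf; rewrite -[RHS](autVK (val g)) -hf.
  by rewrite -[h0]/(aut_fun (Aut h0_aut)) -hE.
apply/coset_ofP; rewrite -/(autf K).
have [_ aM aV] := autf_subgroup K e.
have hA : autf K h by apply: sub_gen_smallest; exists N; split=> //; rewrite hE.
have gA : autf K (g^-1 * h * f) by apply: sub_gen_smallest; exists M; split.
(* [f^-1 * g] is [f^-1 * h * f] times the inverse of [g^-1 * h * f]. *)
have := aM _ _ (autfJ f^-1 hA) (aV _ gA).
by rewrite !invgM !invgK !mulgA !mulgK.
Qed.

End Limits.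

(** * Topological groups presented by ultrafilter limits *)

Lemma ultra_meet Z (U : set_system Z) (A B : set Z) : UltraFilter U ->
  U A -> U B -> exists z, A z /\ B z.
Proof. by move=> UU UA UB; apply: filter_ex (filterI UA UB). Qed.

Section LimitGroups.
Context (G : preTopologicalGroupType).
Variable conv : forall Z : Type, set_system Z -> (Z -> G) -> G -> Prop.

(** [conv U u x] is a notion of limit that determines the topology of [G] without
    being its convergence: for the Lascar group it is convergence of the types of
    chosen representatives, and different choices may give different limits.  In
    [conv_separated], [B] is the image of a basic clopen set of types; it is
    compact but need be neither open nor closed. *)
Record limit_group : Prop := LimitGroup {
  conv_exists : forall Z (U : set_system Z) (u : Z -> G),
    UltraFilter U -> exists x, conv U u x;
  conv_cst : forall Z (U : set_system Z) x,
    UltraFilter U -> conv U (fun=> x) x;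
  conv_divl : forall Z (U : set_system Z) (u v : Z -> G) x y,
    UltraFilter U -> conv U u x -> conv U v y ->
    conv U (fun z => (u z)^-1 * v z) (x^-1 * y);
  closed_conv : forall C : set G, closed C <->
    forall Z (U : set_system Z) (u : Z -> G) x,
    UltraFilter U -> conv U u x -> U [set z | C (u z)] -> C x;
  conv_separated : forall Z (U : set_system Z) (u : Z -> G) x (D : set G),
    UltraFilter U -> conv U u x -> closed D -> ~ D x ->
    exists B : set G, [/\ U [set z | B (u z)], forall y, B y -> ~ D y &
      forall Z' (U' : set_system Z') (w : Z' -> G), UltraFilter U' ->
      U' [set z | B (w z)] -> exists2 y, B y & conv U' w y] }.

Hypothesis convG : limit_group.

Lemma conv_inv Z (U : set_system Z) (u : Z -> G) x : UltraFilter U ->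
  conv U u x -> conv U (fun z => (u z)^-1) x^-1.
Proof.
move=> UU ux; have := conv_divl convG UU ux (conv_cst convG 1 UU).
by under eq_fun do rewrite mulg1; rewrite mulg1.
Qed.

Lemma conv_mul Z (U : set_system Z) (u v : Z -> G) x y : UltraFilter U ->
  conv U u x -> conv U v y -> conv U (fun z => u z * v z) (x * y).
Proof.
move=> UU /conv_inv ux vy; have := conv_divl convG UU ux vy.
by under eq_fun do rewrite invgK; rewrite invgK.
Qed.

Lemma closed_preimage (f : G -> G) (C : set G) :
  (forall Z (U : set_system Z) u x, UltraFilter U ->
    conv U u x -> conv U (fun z => f (u z)) (f x)) ->
  closed C -> closed (f @^-1` C).
Proof.
move=> f_conv C_closed; apply/(closed_conv convG) => Z U u x UU ux.
by apply: (closed_conv convG C).1 (f_conv _ _ _ _ UU ux).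
Qed.

Let H : set G := closure [set 1].

(** All algebraic properties of [H] come from this principle, applied to preimages
    of closed sets under maps that preserve limits. *)
Let H_min (C : set G) : closed C -> C 1 -> H `<=` C.
Proof.
move=> C_closed C1; rewrite /H [X in _ `<=` X](closure_id C).1 //.
by apply: closure_subset => _ ->.
Qed.

Let closed_divl (g : G) (C : set G) : closed C -> closed [set x | C (g^-1 * x)].
Proof.
apply: (@closed_preimage (fun x : G => g^-1 * x)) => Z U u x UU ux.
exact: conv_divl (conv_cst convG _ UU) ux.
Qed.

Let H1 : H 1. Proof. exact: subset_closure. Qed.

Let H_closed : closed H. Proof. exact: closed_closure. Qed.

Let H_divl h k : H h -> H k -> H (h^-1 * k).
Proof.
move=> Hh; have : [set x | H (h^-1 * x)] 1.
  rewrite /= mulg1.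
  suff : H `<=` (fun x => x^-1) @^-1` H by apply.
  apply: H_min; last by rewrite /= invg1.
  by apply: closed_preimage H_closed => *; exact: conv_inv.
by move=> /(H_min (@closed_divl h _ H_closed)); apply.
Qed.

Let H_inv h : H h -> H h^-1.
Proof. by move=> Hh; rewrite -[h^-1]mulg1; exact: H_divl. Qed.

Let H_mul h k : H h -> H k -> H (h * k).
Proof. by move=> /H_inv Hh Hk; rewrite -[h]invgK; exact: H_divl. Qed.

Let H_conj g h : H h -> H (g^-1 * h * g).
Proof.
suff : H `<=` (fun h => g^-1 * h * g) @^-1` H by apply.
apply: H_min; last by rewrite /= mulg1 mulVg.
apply: closed_preimage H_closed => Z U u x UU ux.
apply: conv_mul => //; last exact: conv_cst.
by apply: conv_mul => //; exact: conv_cst.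
Qed.

Let closed_mulH (C : set G) x h : closed C -> C x -> H h -> C (x * h).
Proof.
move=> C_closed Cx; have := @closed_divl x^-1 _ C_closed; rewrite invgK => xC.
have : [set z | C (x * z)] 1 by rewrite /= mulg1.
by move=> /(H_min xC); apply.
Qed.

(** A topological limit and a limit in the sense of [conv] agree modulo the closure
    of [1].  Otherwise [conv_separated] gives a set [B] that contains [u]
    eventually and avoids the coset of [x].  By compactness [B] times [H] is
    closed, and its complement is a neighbourhood of [x] that [u] leaves. *)
Lemma cvg_conv Z (U : set_system Z) (u : Z -> G) x y : UltraFilter U ->
  u @ U --> x -> conv U u y -> H (x^-1 * y).
Proof.
move=> UU ux uy; apply: contrapT => xy.
have [B [UB B_xH B_lim]] :=
  conv_separated convG UU uy (@closed_divl x _ H_closed) xy.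
pose BxH := [set g | exists2 b, B b & H (b^-1 * g)].
have BxH_closed : closed BxH.
  apply/(closed_conv convG) => Z' U' w g UU' wg wBH.
  have /choice[b bP] : forall z, exists b, BxH (w z) -> B b /\ H (b^-1 * w z).
    move=> z; have [[b Bb Hb]|nw] := pselect (BxH (w z)); first by exists b.
    by exists 1.
  have [|y' By' by'] := B_lim _ _ b UU'.
    by apply: filterS wBH => z /bP[].
  exists y' => //; have := conv_divl convG UU' by' wg.
  move=> /((closed_conv convG H).1 H_closed _ _ _ _ UU'); apply.
  by apply: filterS wBH => z /bP[].
have x_notin : ~ BxH x.
  move=> [b Bb Hb]; apply: (B_xH b Bb) => /=.
  by have := H_inv Hb; rewrite invgM invgK.
have UBH : U (u @^-1` (~` BxH)).
  by apply: ux; apply: open_nbhs_nbhs; split=> //; exact: closed_openC.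
have [z [Bz]] := ultra_meet UU UB UBH.
by apply; exists (u z); rewrite ?mulVg.
Qed.

(** If multiplication were discontinuous at [(x, y)], some ultrafilter of pairs
    converging to [(x, y)] would have its products in a closed set [C] missing
    [x * y].  Its [conv]-limits agree with [x] and [y] modulo [H], and their product
    lies in [C], which is a union of cosets of the normal subgroup [H]. *)
Lemma mul_continuous : continuous (fun p : G * G => p.1 * p.2).
Proof.
move=> [x y] O /=; rewrite nbhsE => -[V [V_open Vxy] VO].
suff : nbhs (x, y) [set p : G * G | V (p.1 * p.2)].
  by apply: filterS => p /VO.
apply: contrapT => nV.
pose C := ~` V; have C_closed : closed C by exact: open_closedC.
pose F := within [set p : G * G | C (p.1 * p.2)] (nbhs (x, y)).
have F_proper : ProperFilter F.
  apply: Build_ProperFilter_ex => A FA; apply: contrapT => A0.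
  have {}FA : nbhs (x, y) [set p : G * G | C (p.1 * p.2) -> A p] := FA.
  apply: nV; apply: filterS FA => p pA; apply: contrapT => Vp.
  by apply: A0; exists p; exact: pA.
have [U [UU FU]] := ultraFilterLemma F_proper.
have nbhsU A : nbhs (x, y) A -> U A.
  by move=> nA; apply: FU; apply: filterS nA => p.
have UC : U [set p | C (p.1 * p.2)] by apply: FU; exact: withinT.
have Ux : (fst : G * G -> G) @ U --> x.
  move=> A nA; apply: nbhsU; exact: (cvg_fst (F := nbhs x) (G := nbhs y)).
have Uy : (snd : G * G -> G) @ U --> y.
  move=> A nA; apply: nbhsU; exact: (cvg_snd (F := nbhs x) (G := nbhs y)).
have [x' xx'] := conv_exists convG (fst : G * G -> G) UU.
have [y' yy'] := conv_exists convG (snd : G * G -> G) UU.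
have Hx := cvg_conv UU Ux xx'; have Hy := cvg_conv UU Uy yy'.
have Cxy' : C (x' * y').
  exact: (closed_conv convG C).1 C_closed _ _ _ _ UU (conv_mul UU xx' yy') UC.
suff : C (x * y) by [].
have -> : x * y = x' * y' * ((y'^-1 * y) * (y^-1 * (x'^-1 * x) * y)).
  by rewrite !mulgA !mulgK mulgV mul1g.
apply: closed_mulH => //; apply: H_mul; last apply: H_conj.
  by have := H_inv Hy; rewrite invgM invgK.
by have := H_inv Hx; rewrite invgM invgK.
Qed.

Lemma limit_group_topological : topological_group G.
Proof.
split; first exact: mul_continuous.
apply/continuous_closedP => C; apply: closed_preimage => Z U u x UU.
exact: conv_inv.
Qed.

Lemma limit_group_compact : cover_compact [set: G].
Proof.
pose P : ptopologicalType := HB.pack (PreTopologicalGroup.sort G)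
  (PreTopologicalGroup.class G) (isPointed.Build (PreTopologicalGroup.sort G) 1).
suff : compact [set: P] by rewrite compact_cover.
rewrite (compact_ultra P) => U UU _; have [x ux] := conv_exists convG id UU.
exists x; split=> // A; rewrite nbhsE => -[V [V_open Vx] VA].
apply: filterS VA _; have [//|UC] := in_ultra_setVsetC V UU.
have := (closed_conv convG (~` V)).1 (open_closedC V_open) _ _ _ _ UU ux UC.
by [].
Qed.

End LimitGroups.

(** * The Lascar group *)

Section LascarTopology.
Context (K : Type) (L : language) (S : structure L).
Hypotheses (K_infinite : infinite_set [set: K]) (S_sat : saturated K S)
  (S_hom : strongly_homogeneous K S).
Context (I : Type) (E : (I -> S) -> (I -> S) -> Prop) (a : I -> S).
Hypotheses (I_small : small K [set: I]) (E_equiv : equivalence_relation E)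
  (E_typedef : type_definable_rel E).
Local Notation e := (eclass E a).
Local Notation Aut_e := (aut_over e).
Context (M N : set S).
Hypotheses (M_model : small_model K M) (N_model : small_model K N)
  (dcl_M : in_dcl e M) (dcl_N : in_dcl e N).

Local Notation Gal := (lascar_group_top K e M N).
Local Notation conjugate := (@conjugate L S I E a M N).

Definition gal_class (f : Aut_e) : Gal := lascar_class K f.

Lemma class_surj (x : Gal) : exists f, gal_class f = x.
Proof. by exists (repr x); exact: reprK. Qed.

Lemma class_divl f g : gal_class (f^-1 * g) = (gal_class f)^-1 * gal_class g.
Proof.
by rewrite /gal_class /lascar_class -[RHS]/(quotM (quotV _) _) quotV_coset quotM_coset.
Qed.

Lemma class_eq f g :
  (forall phi, sat (conjugate f) phi <-> sat (conjugate g) phi) ->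
  gal_class f = gal_class g.
Proof. exact: lascar_class_eq. Qed.

Lemma nu_class (f : Aut_e) (p : conjugate_types e M N) :
  val p = tp N (val f \o val) -> nu K p = gal_class f.
Proof.
rewrite /nu; case: cid => g /= pg pf; apply: class_eq => phi.
have := pf; rewrite pg => /(congr1 (fun q => val q phi)) /=.
by rewrite /conjugate => <-.
Qed.

(** Single formulas suffice on the right because they form a basis of the Stone
    topology, and preimages under [nu] can be tested on automorphisms by
    [nu_class]. *)
Lemma lascar_openP (O : set Gal) : open O <->
  forall f, O (gal_class f) -> exists2 phi, sat (conjugate f) phi &
    forall g, sat (conjugate g) phi -> O (gal_class g).
Proof.
have conj_in (f : Aut_e) : tp N (val f \o val) \in conjugate_types e M N.
  by apply/mem_set; exists f.
split=> [[V V_open VO] f Of|H].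
  have {}VO (g : Aut_e) : V (tp N (val g \o val)) <-> O (gal_class g).
    pose pg : conjugate_types e M N := SigSub (conj_in g).
    rewrite -(@nu_class g pg) //.
    by rewrite -[O _]/((nu K (N:=N) @^-1` O) pg) -VO.
  move: V_open VO Of => [D' D'sub <-] VO /VO[W D'W fW].
  have [F _ WE] := D'sub _ D'W; rewrite -WE in fW.
  have [phi phiF] := conjunction S (finite_fset F).
  exists phi; first by apply/phiF => psi /fW.
  by move=> g /phiF gF; apply/VO; exists W => //; rewrite -WE; exact: gF.
pose Psi := [set phi | forall g, sat (conjugate g) phi -> O (gal_class g)].
exists (\bigcup_(phi in Psi) [set p : stone M N | val p phi]).
  apply: bigcup_open => phi _.
  exists [set [set p : stone M N | val p phi]].
    by move=> _ ->; exact: finI_from1.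
  by rewrite bigcup_set1.
apply/seteqP; split=> p; have [f pf] := set_valP p.
  move=> [phi phiPsi phip] /=; rewrite (nu_class pf); apply: phiPsi.
  by have := congr1 (fun q => val q phi) pf => /= <-.
rewrite /= (nu_class pf) => /H[phi fphi phiO].
by exists phi => //; have := congr1 (fun q => val q phi) pf => /= ->.
Qed.

(** Convergence of [tp(f z(M)/N)] to [tp(g(M)/N)] in the Stone space. *)
Definition tends Z (U : set_system Z) (f : Z -> Aut_e) (g : Aut_e) : Prop :=
  forall phi, sat (conjugate g) phi -> U [set z | sat (conjugate (f z)) phi].

Lemma tends_unique Z (U : set_system Z) f g g' : UltraFilter U ->
  tends U f g -> tends U f g' -> gal_class g = gal_class g'.
Proof.
move=> UU fg fg'; apply: class_eq => phi.
suff H g1 g2 : tends U f g1 -> tends U f g2 ->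
    sat (conjugate g1) phi -> sat (conjugate g2) phi by split; exact: H.
move=> fg1 fg2 /fg1 U1; apply: contrapT => /(fg2 (Neg phi)) U2.
by have [z [zphi]] := ultra_meet UU U1 U2; apply.
Qed.

(** The type of [(g1^-1 * g2)(M)] over [N] is that of [g2(M)] over [g1(N)], so it is
    controlled by the joint limit of the two conjugations. *)
Lemma tends_joint Z (U : set_system Z) (f1 f2 : Z -> Aut_e) : UltraFilter U ->
  exists g1 g2, [/\ tends U f1 g1, tends U f2 g2 &
    tends U (fun z => (f1 z)^-1 * f2 z) (g1^-1 * g2)].
Proof.
move=> UU.
have MN_small : small K [set: M + N].
  by apply: small_sum => //; apply/small_set_type; [case: M_model|case: N_model].
pose q : M + N -> S := glue val val.
have [g1 [g2 g12]] := joint_limit K_infinite S_sat S_hom I_small E_equiv E_typedef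
  q f1 f2 MN_small UU.
have transfer (s : M + N -> ((M + N) + (M + N)) + (M + N))
    (h : Z -> Aut_e) (g : Aut_e) :
    (forall phi, sat (conjugate g) phi <->
      sat (glue (glue (val g1 \o q) (val g2 \o q)) q \o s) phi) ->
    (forall z phi, sat (conjugate (h z)) phi <->
      sat (glue (glue (val (f1 z) \o q) (val (f2 z) \o q)) q \o s) phi) ->
    tends U h g.
  move=> gE hE phi /gE; rewrite -sat_rename => /g12; apply: filterS => z /=.
  by rewrite sat_rename => /hE.
have sat_ext (v w : M + N -> S) phi : v =1 w -> (sat v phi <-> sat w phi).
  by move=> /funext ->.
have divE (h1 h2 : Aut_e) phi : sat (conjugate (h1^-1 * h2)) phi <->
    sat (glue (val h2 \o val) (val h1 \o val) : M + N -> S) phi.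
  rewrite -(sat_aut (val h1)); apply: sat_ext => -[x|x] //=.
  exact: (autKV (val h1)).
exists g1, g2; split.
- by apply: (transfer (glue (inl \o inl \o inl) (inr \o inr)))
    => [phi|z phi]; apply: sat_ext => -[].
- by apply: (transfer (glue (inl \o inr \o inl) (inr \o inr)))
    => [phi|z phi]; apply: sat_ext => -[].
- by apply: (transfer (glue (inl \o inr \o inl) (inl \o inl \o inr)))
    => [phi|z phi]; rewrite divE; apply: sat_ext => -[].
Qed.

(** A limit of Lascar classes is taken along representatives, whose choice can affect
    it. *)
Definition conv Z (U : set_system Z) (u : Z -> Gal) (x : Gal) : Prop :=
  exists f g, [/\ forall z, gal_class (f z) = u z, gal_class g = x & tends U f g].

(** Closedness under [conv] implies closedness because a point all of whose basic
    neighbourhoods meet a set is the limit of an ultrafilter containing these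
    neighbourhoods and the set.  For the separation, a formula isolates the
    representative [g] from the closed set [D], and representatives satisfying
    the formula have limits satisfying it. *)
Lemma lascar_limit_group : limit_group conv.
Proof.
split.
- move=> Z U u UU; have /choice[f fu] := fun z => class_surj (u z).
  have [g [_ [fg _ _]]] := tends_joint f f UU.
  by exists (gal_class g), f, g.
- move=> Z U x UU; have [f fx] := class_surj x.
  by exists (fun=> f), f; split=> // phi fphi; apply: filterS filterT => z.
- move=> Z U u v x y UU [f1 [g1 [f1u <- fg1]]] [f2 [g2 [f2v <- fg2]]].
  have [g1' [g2' [fg1' fg2' fg12]]] := tends_joint f1 f2 UU.
  exists (fun z => (f1 z)^-1 * f2 z), (g1'^-1 * g2').
  split=> [z||//]; rewrite class_divl ?f1u ?f2v //.
  by rewrite (tends_unique UU fg1 fg1') (tends_unique UU fg2 fg2').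
- move=> C; split=> [C_closed Z U u x UU [f [g [fu <- fg]]] UC|H].
    apply: contrapT => Cg.
    have [phi /fg Uphi phiC] :=
      (lascar_openP (~` C)).1 (closed_openC C_closed) _ Cg.
    have [z [/= zphi]] := ultra_meet UU Uphi UC.
    by rewrite -fu; exact: phiC.
  rewrite -[C]setCK; apply: open_closedC; apply/lascar_openP => f Cf.
  apply: contrapT => nphi.
  pose B phi := [set g | sat (conjugate g) phi /\ C (gal_class g)].
  have F_proper : ProperFilter (filter_from [set phi | sat (conjugate f) phi] B).
    apply: filter_from_proper.
      apply: filter_from_filter; first by exists (Neg Bot).
      move=> phi psi /= fphi fpsi; exists (Neg (Imp phi (Neg psi))) => /=.
        by apply.
      move=> g [/= gphipsi Cg].
      by split; split=> //; apply: contrapT => ng; apply: gphipsi.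
    move=> phi fphi; apply: contrapT => B0; apply: nphi.
    by exists phi => // g gphi Cg; apply: B0; exists g.
  have [U [UU FU]] := ultraFilterLemma F_proper.
  apply: Cf; apply: (H _ U gal_class _ UU).
    by exists id, f; split=> // phi fphi; apply: FU; exists phi => // g [].
  by apply: FU; exists (Neg Bot) => // g [].
- move=> Z U u x D UU [f [g [fu <- fg]]] D_closed Dg.
  have [phi gphi phiD] := (lascar_openP (~` D)).1 (closed_openC D_closed) _ Dg.
  exists (gal_class @` [set h | sat (conjugate h) phi]); split.
  - by apply: filterS (fg _ gphi) => z zphi; exists (f z).
  - by move=> _ [h /phiD Dh <-].
  move=> Z' U' w UU' wB.
  have /choice[h hP] : forall z, exists h, gal_class h = w z /\
      ((gal_class @` [set h | sat (conjugate h) phi]) (w z) -> sat (conjugate h) phi).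
    move=> z; have [[h hphi hw]|nw] :=
      pselect ((gal_class @` [set h | sat (conjugate h) phi]) (w z)).
      by exists h.
    by have [h hw] := class_surj (w z); exists h; split=> // /nw.
  have [h' [_ [hh' _ _]]] := tends_joint h h UU'.
  exists (gal_class h'); last by exists h, h'; split=> // z; case: (hP z).
  exists h' => //=; apply: contrapT => /(hh' (Neg phi)) Unphi.
  have [z [/= zB]] := ultra_meet UU' wB Unphi.
  by apply; case: (hP z) => _; exact.
Qed.

End LascarTopology.

Theorem corollary1p20 (L : language) (T : theory L) (K : Type)
    (MM : structure L) (I : Type) (E : (I -> MM) -> (I -> MM) -> Prop)
    (a : I -> MM) (M N : set MM)
    (T_complete : complete_theory T)
    (MM_monster : monster K T MM)
    (I_small : small K [set: I])
    (E_equiv : equivalence_relation E)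
    (E_typedef : type_definable_rel E)
    (M_model : small_model K M)
    (N_model : small_model K N)
    (dcl_M : in_dcl (eclass E a) M)
    (dcl_N : in_dcl (eclass E a) N) :
  topological_group (lascar_group_top K (eclass E a) M N) /\
  cover_compact [set: lascar_group_top K (eclass E a) M N].
Proof.
have [_ [formulaK _] S_sat S_hom] := MM_monster.
have K_infinite : infinite_set [set: K].
  apply/infiniteP; apply: card_le_trans formulaK; apply/card_le_injP.
  by exists (fun n => Eqn (Var L n) (Var L n)) => m n [].
have G_limit := lascar_limit_group K_infinite S_sat S_hom I_small E_equiv E_typedef
  M_model N_model dcl_M dcl_N.
split; first exact: limit_group_topological G_limit.
exact: limit_group_compact G_limit.
Qed.
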